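(* Let $G$ be a graph on $V=\{v_1,\dots,v_n\}$ with adjacency matrix $A$, let $S\subseteq V$ be non-empty, let $W=W^S$ and $r={\rm rank}(W)\leq n$. Let ${\rm f}_{r+1},\dots,{\rm f}_n\in\mathbb{R}^n$ be any orthonormal basis of $\ker(W^{\tt T})$ consisting of eigenvectors of $A$, with $A{\rm f}_j=\lambda_j{\rm f}_j$ for $r<j\leq n$ (the non-main eigenvalues for $S$). Then $W_{[0,r-1]}^{\tt T}W_{[0,r-1]}$ is invertible and $$A=W_{[1,r]}\cdot\big(W_{[0,r-1]}^{\tt T}W_{[0,r-1]}\big)^{-1}\cdot W_{[0,r-1]}^{\tt T}+\sum_{j=r+1}^{n}\lambda_j\,{\rm f}_j{\rm f}_j^{\tt T}.$$
   Context: Graphs are finite, simple, undirected. For a graph with adjacency matrix $A$ on $V=\{v_1,\dots,v_n\}$ and non-empty $S\subseteq V$ with characteristic vector ${\rm e}\in\{0,1\}^n$: $W_{[i,j]}=[A^i{\rm e},A^{i+1}{\rm e},\dots,A^j{\rm e}]$ for $0\le i\le j$, and $W=W^S=W_{[0,n-1]}$ is the walk matrix. *)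

(* Defs.v *)
From HB Require Import structures.
From mathcomp Require Import all_boot all_order all_algebra.
From mathcomp Require Import reals.

Set Implicit Arguments.
Unset Strict Implicit.
Unset Printing Implicit Defensive.

Import GRing.Theory.
Local Open Scope ring_scope.

Definition adjmx (R : nzRingType) (n : nat) (adj : rel 'I_n) : 'M[R]_n :=
  \matrix_(i, j) (adj i j)%:R.

Definition charvec (R : nzRingType) (n : nat) (S : {set 'I_n}) : 'cV[R]_n :=
  \col_i (i \in S)%:R.

(* [A^i e, A^(i+1) e, ..., A^(i+m-1) e], where e is the characteristic vector
   of S.  The second argument is the number of columns rather than the last
   exponent, so that the block W_[i,j] is [walk_block A S i (j - i + 1)]; thus
   W_[0,r-1] and W_[1,r] are [walk_block A S 0 r] and [walk_block A S 1 r], both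
   of type 'M_(n, r). *)
Definition walk_block (R : nzRingType) (n : nat) (A : 'M[R]_n)
    (S : {set 'I_n}) (i m : nat) : 'M[R]_(n, m) :=
  \matrix_(k < n, l < m) (A ^+ (i + l) *m charvec R S) k 0.

Definition walkmx (R : nzRingType) (n : nat) (A : 'M[R]_n) (S : {set 'I_n}) :
    'M[R]_n :=
  walk_block A S 0 n.

(* The kernel of M acting on column vectors; the library's [kermx] is the
   kernel of the action on row vectors. *)
Definition colker (R : fieldType) (m n : nat) (M : 'M[R]_(m, n)) :
    {vspace 'cV[R]_n} :=
  lker (linfun (mulmx M)).

Definition orthonormal_cols (R : nzRingType) (n k : nat)
    (f : 'I_k -> 'cV[R]_n) : Prop :=
  forall i j, (f i)^T *m f j = (i == j)%:R%:M.

(* Main.v *)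
(* Once a Krylov vector A^m e lies in the span of its predecessors, that span is
   A-invariant and contains all later A^i e.  Hence the first r = rank W columns
   of W are independent and span its column space, so every vector is the sum of
   one in the column space of W_[0,r-1] and one in ker W^T = span(f_j).  On the
   former both sides of the formula agree because A W_[0,r-1] = W_[1,r], on the
   latter because the f_j are orthonormal eigenvectors orthogonal to
   W_[0,r-1]. *)
Require Import Defs.
From HB Require Import structures.
From mathcomp Require Import all_boot all_order all_algebra.
From mathcomp Require Import reals.

Set Implicit Arguments.
Unset Strict Implicit.
Unset Printing Implicit Defensive.

Import Order.TTheory GRing.Theory Num.Theory.
Local Open Scope ring_scope.

Lemma mulmx_walk_block (R : nzRingType) (n : nat) (A : 'M[R]_n)
    (S : {set 'I_n}) (i m : nat) :
  A *m walk_block A S i m = walk_block A S i.+1 m.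
Proof.
apply/matrixP => k l; rewrite [RHS]mxE addSn exprS -[A * _]/(A *m _) -mulmxA.
by rewrite !mxE; apply: eq_bigr => p _; rewrite !mxE.
Qed.

Section Krylov.
Variables (F : fieldType) (n : nat) (A : 'M[F]_n) (S : {set 'I_n}).

(** Krylov vectors are transposed so that column spans become row spaces, comparable by [<=%MS]. *)
Let v i : 'rV[F]_n := (A ^+ i *m charvec F S)^T.
Let K m := (walk_block A S 0 m)^T.

Let row_K m (l : 'I_m) : row l (K m) = v l.
Proof. by apply/rowP => k; rewrite !mxE add0n. Qed.

Let v_sub_K i m : (i < m)%N -> (v i <= K m)%MS.
Proof. by move=> lt_im; rewrite -(row_K (Ordinal lt_im)) row_sub. Qed.

Let K_subP m p (B : 'M[F]_(p, n)) :
  (forall i, (i < m)%N -> (v i <= B)%MS) -> (K m <= B)%MS.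
Proof. by move=> vB; apply/row_subP => l; rewrite row_K vB. Qed.

Let v_mul i : v i *m A^T = v i.+1.
Proof. by rewrite /v -trmx_mul exprS -[A * _]/(A *m _) mulmxA. Qed.

(** Multiplication by [A^T] sends row [l] of [K m] to [v l.+1], which is a later row or, for the
    last one, [v m]; so the row space is stable and induction on [i] applies. *)
Let K_stable m i : (v m <= K m)%MS -> (v i <= K m)%MS.
Proof.
move=> vm; have stK : (K m *m A^T <= K m)%MS.
  apply/row_subP => l; rewrite row_mul row_K v_mul.
  have := ltn_ord l; rewrite leq_eqVlt => /orP[/eqP -> //|]; exact: v_sub_K.
elim: i => [|i IHi]; last first.
  by rewrite -v_mul (submx_trans _ stK) // submxMr.
(* If [m = 0] the goal is the hypothesis itself; otherwise [v 0] is a row of [K m]. *)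
by case: m vm {stK} => [//|m _]; apply: v_sub_K.
Qed.

(** Each new row raises the rank: if [v m] lay in [K m], all of [K n] would, and the rank of the
    walk matrix would be at most [m]. *)
Lemma rank_walk_block_full m :
  (m <= \rank (walk_block A S 0 n))%N -> \rank (walk_block A S 0 m) = m.
Proof.
rewrite -(mxrank_tr (walk_block A S 0 m)) -/(K m).
elim: m => [|m IHm] lt_mr; first by apply/eqP; rewrite -leqn0 rank_leq_row.
have rKm := IHm (ltnW lt_mr).
have nvm : ~~ (v m <= K m)%MS.
  apply: contraL lt_mr => vm; rewrite -leqNgt -[leqRHS]rKm -mxrank_tr.
  by apply/mxrankS/K_subP => i _; apply: K_stable.
apply/eqP; rewrite eqn_leq rank_leq_row -{1}rKm rank_ltmx // ltmxE.
apply/andP; split; first by apply: K_subP => i /leqW; apply: v_sub_K.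
by apply: contra nvm; apply: submx_trans; apply: v_sub_K.
Qed.

Lemma walk_block_sub_rank m : m = \rank (walk_block A S 0 n) ->
  ((walk_block A S 0 n)^T <= (walk_block A S 0 m)^T)%MS.
Proof.
move=> rm; have le_mn : (m <= n)%N by rewrite rm rank_leq_row.
have sKK : (K m <= K n)%MS.
  by apply: K_subP => i lt_im; apply/v_sub_K/(leq_trans lt_im).
rewrite -/(K n) -/(K m) -(geq_leqif (mxrank_leqif_sup sKK)) !mxrank_tr -rm.
by rewrite rank_walk_block_full // -rm.
Qed.

End Krylov.

(** If [x] kills the Gram matrix, then [y = x *m B^T] satisfies [y *m y^T = 0], a vanishing sum of
    squares; so [y = 0], and [x = 0] by full rank. *)
Lemma gram_unitmx (R : realFieldType) (m n : nat) (B : 'M[R]_(n, m)) :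
  \rank B = m -> B^T *m B \in unitmx.
Proof.
move=> rB; have freeBT : row_free B^T by rewrite /row_free mxrank_tr rB.
have self_orth0 (y : 'rV[R]_n) : y *m y^T = 0 -> y = 0.
  move=> /matrixP/(_ 0 0); rewrite !mxE => /eqP.
  rewrite psumr_eq0 => [/allP sq0 | k _]; last by rewrite mxE -expr2 sqr_ge0.
  apply/rowP => k; have := sq0 k (mem_index_enum k).
  by rewrite !mxE -expr2 sqrf_eq0 => /eqP.
rewrite -row_free_unit; apply/inj_row_free => x xG.
apply: (row_free_inj freeBT); rewrite mul0mx; apply: self_orth0.
by rewrite trmx_mul trmxK mulmxA -(mulmxA x) xG mul0mx.
Qed.

Theorem theorem5p3 (R : realType) (n : nat) (adj : rel 'I_n)
    (adj_sym : symmetric adj) (adj_irr : irreflexive adj)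
    (S : {set 'I_n}) (S_neq0 : S != set0)
    (r : nat) (rank_W : \rank (walkmx (adjmx R adj) S) = r)
    (f : 'I_(n - r) -> 'cV[R]_n) (lambda : 'I_(n - r) -> R)
    (f_orthonormal : orthonormal_cols f)
    (f_basis : basis_of (colker (walkmx (adjmx R adj) S)^T)
                        [seq f j | j : 'I_(n - r)])
    (f_eigen : forall j, adjmx R adj *m f j = lambda j *: f j) :
  let A := adjmx R adj in
  let W0 := walk_block A S 0 r in
  let W1 := walk_block A S 1 r in
  W0^T *m W0 \in unitmx /\
  A = W1 *m invmx (W0^T *m W0) *m W0^T
      + \sum_(j < n - r) lambda j *: (f j *m (f j)^T).
Proof.
move=> A W0 W1; set W := walkmx A S in rank_W f_basis.
have rank_W0 : \rank W0 = r.
  by apply: rank_walk_block_full; rewrite -/(walkmx A S) -/W rank_W.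
have GU : W0^T *m W0 \in unitmx by apply: gram_unitmx.
(* This factorization gives the inclusion of the kernel of [W0^T] in that of [W^T], used in
   [Dker]. *)
have [C WC] : exists C, W^T = C *m W0^T.
  by apply/submxP/walk_block_sub_rank; rewrite -/(walkmx A S) -/W rank_W.
have le_rn : (r <= n)%N by rewrite -rank_W rank_leq_row.
have W0f j : W0^T *m f j = 0.
  have : f j \in colker W^T.
    by rewrite -(span_basis f_basis) memv_span // image_f.
  rewrite memv_ker lfunE /= => /eqP Wf.
  apply/row_matrixP => l; rewrite row_mul row0.
  suff -> : row l W0^T = row (widen_ord le_rn l) W^T by rewrite -row_mul Wf row0.
  by apply/rowP => k; rewrite !mxE.
split=> //; apply/eqP; rewrite -subr_eq0; apply/eqP.
set D := A - _.
have DW0 : D *m W0 = 0.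
  rewrite mulmxBl mulmxDl mulmx_walk_block -!mulmxA mulVmx // mulmx1.
  rewrite mulmx_suml big1 ?addr0 ?subrr // => j _.
  rewrite -scalemxAl -mulmxA -[W0 in _ *m (_ *m W0)]trmxK -trmx_mul W0f.
  by rewrite trmx0 mulmx0 scaler0.
have Df j : D *m f j = 0.
  rewrite mulmxBl mulmxDl f_eigen -!mulmxA W0f !mulmx0 add0r mulmx_suml.
  rewrite (bigD1 j) //= big1 => [|k /negPf kj].
    by rewrite -scalemxAl -mulmxA f_orthonormal eqxx mulmx1 addr0 subrr.
  by rewrite -scalemxAl -mulmxA f_orthonormal kj raddf0 mulmx0 scaler0.
have Dker (y : 'cV_n) : W0^T *m y = 0 -> D *m y = 0.
  move=> W0y; have : y \in colker W^T.
    by rewrite memv_ker lfunE /= WC -mulmxA W0y mulmx0.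
  rewrite -(span_basis f_basis) => yf.
  have /subvP/(_ y yf) :
      (<<[seq f j | j : 'I_(n - r)]>> <= lker (linfun (mulmx D)))%VS.
    by apply/span_subvP => _ /imageP[j _ ->]; rewrite memv_ker lfunE /= Df.
  by rewrite memv_ker lfunE => /eqP.
(* [P] is the orthogonal projection onto the column space of [W0]. *)
pose P := W0 *m invmx (W0^T *m W0) *m W0^T.
have DP : D *m P = 0 by rewrite /P !mulmxA DW0 !mul0mx.
have W0P : W0^T *m P = W0^T by rewrite /P !mulmxA mulmxV // mul1mx.
apply/trmx_inj/row_matrixP => k; rewrite trmx0 row0 -tr_col; apply/trmx_inj.
(* Since [D *m P = 0], [D] equals [D *m (1%:M - P)], and every column of [1%:M - P] is killed by
   [W0^T]. *)
rewrite trmxK trmx0 -[D]mulmx1 -(subrK P 1%:M) mulmxDr DP addr0.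
rewrite colE -mulmxA; apply: Dker.
by rewrite mulmxA mulmxBr mulmx1 W0P subrr mul0mx.
Qed.
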